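(* Let $d$ and $s$ be integers with $1\le s\le d/2$. There exists $n_0=n_0(d,s)$ such that for all $n\ge n_0$ the following holds. Suppose $\mathcal F\subseteq \binom{[n]}{d+1}$ is an $s$-witness family. Then $|\mathcal F|\le \binom{n-1}{d}$. Moreover, if $|\mathcal F|=\binom{n-1}{d}$, then $\mathcal F$ is a star, i.e. there is an element $x\in[n]$ contained in every member of $\mathcal F$.
   Context: $[n]=\{1,\dots,n\}$ and $\binom{[n]}{d+1}$ denotes the family of all $(d+1)$-element subsets of $[n]$. For $n\ge d+1$ and $0\le s\le d$, a family $\mathcal F\subseteq\binom{[n]}{d+1}$ is an $s$-witness family if for every $F\in\mathcal F$ there exists $B_F\subseteq F$ with $|B_F|=s$ such that $F\cap F'\neq B_F$ for every $F'\in\mathcal F$. *)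

(* Defs.v *)
From mathcomp Require Import all_boot.
Set Implicit Arguments. Unset Strict Implicit. Unset Printing Implicit Defensive.

Definition uniform_family (n k : nat) (F : {set {set 'I_n}}) : Prop :=
  forall A, A \in F -> #|A| = k.

Definition s_witness_family (n s : nat) (F : {set {set 'I_n}}) : Prop :=
  forall A, A \in F ->
    exists B : {set 'I_n},
      [/\ B \subset A, #|B| = s &
          forall A', A' \in F -> A :&: A' != B].

Definition is_star (n : nat) (F : {set {set 'I_n}}) : Prop :=
  exists x : 'I_n, forall A, A \in F -> x \in A.

(* Main.v *)
Require Import Defs.
From mathcomp Require Import all_boot.
From mathcomp Require Import zify.
Set Implicit Arguments. Unset Strict Implicit. Unset Printing Implicit Defensive.

(** Put the members [A] of [F] into fibers according to their witness [W A]. If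
    the fiber of an [s]-set [B] has more than [(d + 1)^2 n^(d - s - 1)] members,
    then [B] is heavy: some centre [c B] outside [B] lies in every member of [F]
    that contains [B]. Only O(n^(d - 1)) members have a light witness, and on the
    others [A |-> A \ c (W A)] is injective into the [d]-sets. Hence, if [F] is as
    large as a star, almost every [d]-set is such a base. As [2 s <= d], a [d]-set
    can contain two disjoint witnesses, and it is not a base if their centres
    differ and lie outside it, so a single point [x] is the centre for a positive
    fraction of [F].

    Now let [R] be the set of the members avoiding [x]. The bases of its heavy
    members are [d]-sets [D] with [x] outside [D] and [x + D] outside [F], so they
    compensate for those members. The light members number at most
    O(|W(R)| n^(d - s - 1)). They are outweighed by further such [D] of order
    |W(R)| n^(d - s), built from [W G] for [G] in [R] and the witnesses of the
    many members through [x], which are not bases of members of [R]. *)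

(** * Double counting and bounds for binomial coefficients *)

Lemma double_count (X Y : finType) (A : {set X}) (B : {set Y})
    (r : X -> Y -> bool) m M :
  {in A, forall a, m <= #|[set b in B | r a b]|} ->
  {in B, forall b, #|[set a in A | r a b]| <= M} ->
  #|A| * m <= #|B| * M.
Proof.
move=> hm hM; rewrite -!sum_nat_const.
apply: (@leq_trans (\sum_(a in A) \sum_(b in B | r a b) 1)).
  by apply: leq_sum => a /hm; rewrite -sum1_card; under eq_bigl do rewrite inE.
rewrite (exchange_big_dep (mem B)) /=; last by move=> a b _ /andP[].
apply: leq_sum => b bB; apply: leq_trans (hM b bB).
by rewrite -sum1_card; under [leqRHS]eq_bigl do rewrite inE;
   under eq_bigl do rewrite bB.
Qed.

Lemma leq_bin_exp n m : 'C(n, m) <= n ^ m.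
Proof.
apply: (@leq_trans (n ^_ m)).
  by rewrite -bin_ffact leq_pmulr // fact_gt0.
elim: m n => [|m IH] n //; rewrite ffactnS expnS leq_mul //.
apply: leq_trans (IH _) _; case: m {IH} => // m.
by rewrite leq_exp2r // leq_pred.
Qed.

(** As [n <= 2 * (n - c - j)], each factor of the falling factorial is at least [n / 2]; so powers
    and binomials agree up to a constant depending only on [d]. *)
Lemma leq_exp_bin n c j d :
  j <= d -> 2 * (c + d) <= n -> n ^ j <= 2 ^ d * d`! * 'C(n - c, j).
Proof.
move=> jd nlarge.
have ffact_ge m i : (m - i) ^ i <= m ^_ i.
  elim: i m => [|i IH] m //; rewrite ffactnS expnS leq_mul ?leq_subr //.
  by apply: leq_trans (IH _); rewrite -subn1 -subnDA add1n.
have le1 : n ^ j <= 2 ^ j * (n - c - j) ^ j.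
  rewrite -expnMn; case: j jd => // j jd; rewrite leq_exp2r //; lia.
apply: (leq_trans le1); apply: leq_trans (leq_mul (leqnn _) (ffact_ge _ _)) _.
rewrite -bin_ffact mulnCA mulnC leq_mul // leq_mul ?leq_pexp2l //.
exact: leq_fact.
Qed.

(** * Counting the sets of given size above a fixed set *)

Section Supersets.

Variable T : finType.
Implicit Types A B Z Y : {set T}.

Lemma card_superset_le Z m :
  #|[set A : {set T} | (Z \subset A) && (#|A| == m)]| <= #|T| ^ (m - #|Z|).
Proof.
apply: leq_trans (leq_bin_exp _ _); rewrite -card_draws.
rewrite -(@card_in_imset _ _ (fun A => A :\: Z)) => [|A B].
  apply/subset_leq_card/subsetP => _ /imsetP[A + ->].
  by rewrite !inE => /andP[ZA /eqP<-]; rewrite cardsDS.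
rewrite !inE => /andP[ZA _] /andP[ZB _] eqAB.
by rewrite -(setID A Z) -(setID B Z) eqAB (setIidPr ZA) (setIidPr ZB).
Qed.

(** Any [m - #|Z|] points outside [Z :|: Y] complete [Z] to such a set, and distinct choices give
    distinct sets. *)
Lemma card_superset_ge Z Y m c :
  [disjoint Z & Y] -> #|Z| <= m -> #|Z :|: Y| <= c ->
  'C(#|T| - c, m - #|Z|) <=
    #|[set A : {set T} | [&& Z \subset A, #|A| == m & [disjoint A & Y]]]|.
Proof.
move=> dZY Zm ZYc.
apply: (@leq_trans 'C(#|~: (Z :|: Y)|, m - #|Z|)).
  by apply: leq_bin2l; rewrite cardsCs setCK leq_sub2l.
rewrite -cards_draws -(@card_in_imset _ _ (fun A => Z :|: A)) => [|A B].
  apply/subset_leq_card/subsetP => _ /imsetP[A + ->].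
  rewrite !inE setCU subsetI -!disjoints_subset => /andP[/andP[AZ AY] /eqP cA].
  rewrite subsetUl cardsU setIC (disjoint_setI0 AZ) cards0 subn0 cA subnKC //.
  by rewrite eqxx -setI_eq0 setIUl setU_eq0 !setI_eq0 dZY AY.
rewrite !inE => /andP[+ _] /andP[+ _] eqAB.
have key (C : {set T}) : C \subset ~: (Z :|: Y) -> C = (Z :|: C) :\: Z.
  rewrite setCU subsetI => /andP[CZ _].
  by rewrite setDUl setDv set0U; apply/esym/setDidPl; rewrite disjoints_subset.
by move=> /key -> /key ->; rewrite eqAB.
Qed.

End Supersets.

(** * Fibers of the witness map and centres of heavy sets *)

Section Witness.

Variables (T : finType) (d s : nat) (F : {set {set T}}) (W : {set T} -> {set T}).
Hypothesis s_le_d : 2 * s <= d.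
Hypothesis FT : {in F, forall A : {set T}, #|A| = d.+1}.
Hypothesis WS : {in F, forall A : {set T}, W A \subset A}.
Hypothesis Ws : {in F, forall A : {set T}, #|W A| = s}.
Hypothesis WP : {in F &, forall A A' : {set T}, A :&: A' != W A}.

Local Notation n := #|T|.
Implicit Types A B D E G Z Y : {set T}.

Definition fiber B := [set A in F | W A == B].
(** The exponent is [d + 1 - (s + 2)], the number of free points of a member once [s + 2] of its
    points are prescribed. *)
Definition heavy B := d.+1 ^ 2 * n ^ (d - s).-1 < #|fiber B|.

(* If every point [y] outside [B] is missed by some [G y] in [F] containing [B],
   each member of the fiber meets [A0] and then [G y] outside [B], hence contains
   one of at most [(d + 1)^2] sets of size [s + 2]. *)
Lemma heavy_center B :
  heavy B -> exists y, y \notin B /\ {in F, forall G : {set T}, B \subset G -> y \in G}.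
Proof.
move=> hB; have [A0 A0B] : exists A0, A0 \in fiber B.
  by apply/set0Pn; rewrite -card_gt0; apply: leq_trans hB.
case: (pickP [pred y | (y \notin B) &&
    [forall G, (G \in F) && (B \subset G) ==> (y \in G)]]) => [y|noy].
  move=> /= /andP[yB /forallP yG]; exists y; split=> // G GF BG.
  by move/implyP: (yG G) => -> //; rewrite GF.
have [g gP] : exists g : T -> {set T}, forall y, y \notin B ->
    [/\ g y \in F, B \subset g y & y \notin g y].
  apply: (@fin_all_exists T (fun=> {set T})
     (fun y G => y \notin B -> [/\ G \in F, B \subset G & y \notin G])) => y.
  have /= := noy y; case: (y \notin B) => /=; last by exists set0.
  move/negbT; rewrite negb_forall => /existsP[G].
  by rewrite negb_imply => /andP[/andP[? ?] ?]; exists G.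
have [A0F /eqP WA0] : A0 \in F /\ W A0 == B by move: A0B; rewrite inE => /andP.
have cB : #|B| = s by rewrite -WA0 Ws.
(* [A :&: G] contains [B = W A] but differs from it, so it has a point outside [B]. *)
have meet A G : A \in fiber B -> G \in F -> B \subset G ->
    exists2 z, z \in A & (z \in G) && (z \notin B).
  rewrite inE => /andP[AF /eqP WA] GF BG.
  have : ~~ (A :&: G \subset B).
    apply: contra (WP AF GF) => h; rewrite WA eqEsubset h subsetI BG andbT.
    by rewrite -WA WS.
  case/subsetPn => z; rewrite inE => /andP[zA zG] zB; exists z => //.
  by rewrite zG.
(* A pair in [I] is a point [y] of [A0] outside [B] with a point [z] of [g y] outside [B]; both
   range over sets of size at most [d + 1]. *)
pose I := [set p : T * T | [&& p.1 \in A0, p.1 \notin B,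
   p.2 \in g p.1 & p.2 \notin B]].
have cI : #|I| <= d.+1 ^ 2.
  rewrite -[#|I|]muln1 -mulnn -[X in _ <= X * _](FT A0F).
  apply: (@double_count _ _ I A0 (fun p y => p.1 == y)) => [p|y yA0].
    rewrite inE => /and4P[pA0 _ _ _]; rewrite card_gt0; apply/set0Pn.
    by exists p.1; rewrite inE pA0 eqxx.
  have [yB|yB] := boolP (y \in B).
    rewrite [finset _](_ : _ = set0) ?cards0 //; apply/setP => p.
    by rewrite !inE; case: eqP => [->|]; rewrite ?andbF // yB andbF.
  have [gyF _ _] := gP y yB; rewrite -(FT gyF).
  rewrite -(@card_in_imset _ _ snd) => [|p q].
    apply/subset_leq_card/subsetP => _ /imsetP[p + ->].
    by rewrite !inE => /andP[/and4P[_ _ + _] /eqP<-].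
  rewrite !inE => /andP[_ /eqP p1] /andP[_ /eqP q1].
  by case: p q p1 q1 => [a b] [a' b'] /= -> -> ->.
move: hB; rewrite /heavy ltnNge => /negP[].
rewrite -[#|_|]muln1; apply: leq_trans (leq_mul cI (leqnn _)).
apply: (@double_count _ _ _ _
   (fun A p => (p.1 \in A) && (p.2 \in A))) => [A AB|[y z]].
  have BA0 : B \subset A0 by rewrite -WA0 WS.
  have [y yA /andP[yA0 yB]] := meet A A0 AB A0F BA0.
  have [gF Bg yg] := gP y yB.
  have [z zA /andP[zg zB]] := meet A _ AB gF Bg.
  rewrite card_gt0; apply/set0Pn; exists (y, z).
  by rewrite !inE /= yA0 yB zg zB yA zA.
rewrite inE /= => /and4P[yA0 yB zg zB].
have [gF Bg yg] := gP y yB.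
have nyz : z != y by apply: contraNneq yg => {1}<-.
have cZ : #|z |: (y |: B)| = s.+2.
  by rewrite !cardsU1 !inE negb_or nyz zB yB cB.
apply: leq_trans (_ : _ <= n ^ (d.+1 - s.+2)) _; last first.
  by rewrite subSS subnS.
rewrite -cZ; apply: leq_trans (card_superset_le _ _).
apply/subset_leq_card/subsetP => A; rewrite !inE => /andP[/andP[AF /eqP WA]].
move=> /andP[yA zA]; rewrite !subUset !sub1set yA zA (FT AF) eqxx -WA.
by rewrite WS.
Qed.

(** * Bases of heavy members *)

Section Center.

Variable c : {set T} -> T.
Hypothesis cP : forall B, heavy B ->
  c B \notin B /\ {in F, forall G : {set T}, B \subset G -> c B \in G}.

Definition heavies := [set A in F | heavy (W A)].
Definition base A := A :\ c (W A).

Lemma heaviesP A : A \in heavies ->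
  [/\ A \in F, c (W A) \in A, c (W A) \notin W A, W A \subset base A &
      #|base A| = d].
Proof.
rewrite inE => /andP[AF hA]; have [cW /(_ A AF (WS AF)) cA] := cP hA.
split=> //; first by rewrite subsetD1 WS.
by apply/eqP; rewrite -eqSS -[d.+1](FT AF) (cardsD1 (c (W A)) A) cA.
Qed.

Lemma baseK A : A \in heavies -> c (W A) |: base A = A.
Proof. by case/heaviesP=> _ cA _ _ _; rewrite setD1K. Qed.

Lemma center_heavies A G : A \in heavies -> G \in F -> W A \subset G ->
  c (W A) \in G.
Proof. by rewrite inE => /andP[_ /cP[_ h]] /h. Qed.

(** The common base contains [W A], so [c (W A)] lies in [G]; being outside the base, it must be
    [c (W G)]. *)
Lemma base_inj : {in heavies &, injective base}.
Proof.
move=> A G Ah Gh eqb; have [_ _ _ WA _] := heaviesP Ah.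
have [GF _ _ _ _] := heaviesP Gh.
have : c (W A) \in G.
  by apply: center_heavies => //; apply: subset_trans WA _; rewrite eqb subsetDl.
rewrite -{1}(baseK Gh) in_setU1 -eqb in_setD1 eqxx orbF => /eqP eqc.
by rewrite -(baseK Ah) -(baseK Gh) eqb eqc.
Qed.

(** Each light fiber is bounded by the heaviness threshold, and at most [#|W @: R|] fibers occur. *)
Lemma card_light (R : {set {set T}}) : R \subset F ->
  #|R :\: heavies| <= #|W @: R| * (d.+1 ^ 2 * n ^ (d - s).-1).
Proof.
move=> RF; rewrite -[#|_|]muln1.
apply: (@double_count _ _ _ _ (fun A B => W A == B)) => [A|B _].
  rewrite inE => /andP[_ AR]; rewrite card_gt0; apply/set0Pn; exists (W A).
  by rewrite inE eqxx imset_f.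
have [hB|] := boolP (heavy B); last first.
  rewrite -leqNgt; apply: leq_trans; apply/subset_leq_card/subsetP => A.
  by rewrite !inE => /andP[/andP[_ /(subsetP RF)->]].
rewrite [finset _](_ : _ = set0) ?cards0 //; apply/setP => A; rewrite !inE.
have [AR|] := boolP (A \in R); last by rewrite andbF.
by rewrite (subsetP RF _ AR); case: eqP => [->|]; rewrite ?hB ?andbF.
Qed.

Lemma card_witness_sub (Q : {set {set T}}) E M : Q \subset F ->
  (forall B, #|B| = s -> #|[set A in Q | W A == B]| <= M) ->
  #|[set A in Q | W A \subset E]| <= 2 ^ #|E| * M.
Proof.
move=> QF hM; rewrite -[X in X <= _]muln1 -card_powerset.
apply: (@double_count _ _ _ _ (fun A B => W A == B)) => [A|B _].
  rewrite inE => /andP[AQ AE]; rewrite card_gt0; apply/set0Pn; exists (W A).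
  by rewrite !inE AE eqxx.
have [cB|cB] := eqVneq #|B| s.
  apply: leq_trans (hM B cB); apply/subset_leq_card/subsetP => A.
  by rewrite !inE => /andP[/andP[-> _] ->].
rewrite [finset _](_ : _ = set0) ?cards0 //; apply/setP => A; rewrite !inE.
apply: contra_neqF cB => /andP[/andP[AQ _] /eqP <-].
by rewrite Ws // (subsetP QF).
Qed.

(** Counting bases in place of members saves a factor [n] in each fiber. *)
Lemma card_heavies_sub E :
  #|[set A in heavies | W A \subset E]| <= 2 ^ #|E| * n ^ (d - s).
Proof.
have hF : heavies \subset F by apply/subsetP => A /heaviesP[].
apply: card_witness_sub => // B cB.
rewrite -cB -(@card_in_imset _ _ base) => [|A G]; last first.
  by move=> /setIdP[Ah _] /setIdP[Gh _]; apply: base_inj.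
apply: leq_trans (card_superset_le _ _).
apply/subset_leq_card/subsetP => _ /imsetP[A + ->].
move=> /setIdP[/heaviesP[_ _ _ sW cb] /eqP WA].
by rewrite inE cb eqxx -WA sW.
Qed.

(** * Existence of a popular centre *)

Lemma exp_predE m : 0 < m -> n ^ m = n * n ^ m.-1.
Proof. by case: m => // m _; rewrite expnS. Qed.

(** If no centre is popular, at least half of all pairs of heavy members are good, and each yields
    about [n ^ (d - 2 * s)] sets of size [d] that are not bases. Such a set arises from at most
    [q * q] pairs, so [n ^ (3 * d - 2 * s)] would be at most a constant times
    [n ^ (3 * d - 2 * s - 1)]. *)
Lemma popular_center P K :
  0 < s ->
  n ^ d <= P * #|heavies| ->
  #|[set E : {set T} | #|E| == d] :\: base @: heavies| <= K * n ^ d.-1 ->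
  4 * s.+1 * P <= n -> 2 * ((2 * s).+2 + d) <= n ->
  2 * P ^ 2 * (2 ^ d * d`!) * K * 4 ^ d < n ->
  exists x, n ^ d <= 4 * s.+1 * P * #|[set A in heavies | c (W A) == x]|.
Proof.
move=> s_gt0 hP missK n1 n2 n3.
have n_gt0 : 0 < n by apply: leq_trans n3.
have d_gt0 : 0 < d by lia.
have nd_gt0 : 0 < n ^ d by rewrite expn_gt0 n_gt0.
have P_gt0 : 0 < P by move: (leq_trans nd_gt0 hP); rewrite muln_gt0 => /andP[].
set pop := fun x => [set A in heavies | c (W A) == x].
case: (pickP [pred x | n ^ d <= 4 * s.+1 * P * #|pop x|]) => [x|nopop].
  by exists x.
exfalso; set h := #|heavies| in hP.
have popM x : #|pop x| <= h %/ (4 * s.+1).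
  rewrite leq_divRL // -(leq_pmul2l P_gt0).
  have -> : P * (#|pop x| * (4 * s.+1)) = 4 * s.+1 * P * #|pop x| by lia.
  by apply: leq_trans hP; rewrite ltnW // ltnNge; apply/negbT/nopop.
have nh : 4 * s.+1 * n ^ d.-1 <= h.
  rewrite -(leq_pmul2l P_gt0); apply: leq_trans hP.
  by rewrite (exp_predE d_gt0) mulnA leq_mul2r [P * _]mulnC n1 orbT.
(* Goodness makes the two witnesses disjoint, the two centres distinct, and both centres foreign to
   both witnesses. *)
pose good A1 A2 := (c (W A2) \notin c (W A1) |: W A1) &&
   [disjoint base A2 & c (W A1) |: W A1].
have manygood A1 : A1 \in heavies ->
    uphalf h <= #|[set A2 in heavies | good A1 A2]|.
  move=> A1h; have [A1F _ cW _ _] := heaviesP A1h.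
  set gd := [set A2 in heavies | _].
  have gdh : gd \subset heavies by apply/subsetP => A /setIdP[].
  (* A bad [A2] has its centre or a base point among [s + 1] points. By [popM] and [nh], each of the
     two cases accounts for at most a quarter of [h]. *)
  suff : #|heavies :\: gd| * 1 <=
         #|c (W A1) |: W A1| * (h %/ (4 * s.+1) + n ^ d.-1).
    rewrite cardsDS // cardsU1 cW Ws //.
    by have := leq_divM h (4 * s.+1); move: nh; rewrite -/h; nia.
  apply: (@double_count _ _ _ _
     (fun A v => (c (W A) == v) || (v \in base A))) => [A|v _].
    rewrite !inE => /andP[+ Ah]; rewrite Ah /= negb_and negbK.
    rewrite card_gt0 => hA; apply/set0Pn; case/orP: hA => [cA|].
      by exists (c (W A)); apply/setIdP; rewrite eqxx.
    rewrite -setI_eq0 => /set0Pn[v /setIP[vA vB]].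
    by exists v; apply/setIdP; rewrite vA orbT.
  apply: leq_trans (leq_add (popM v) (leqnn _)).
  have le2 : #|[set A in heavies | v \in base A]| <= n ^ d.-1.
    rewrite -(@card_in_imset _ _ base) => [|A G]; last first.
      by move=> /setIdP[Ah _] /setIdP[Gh _]; apply: base_inj.
    rewrite -subn1 -(cards1 v); apply: leq_trans (card_superset_le _ _).
    apply/subset_leq_card/subsetP => _ /imsetP[A /setIdP[Ah vA] ->].
    by rewrite inE sub1set vA; have [_ _ _ _ ->] := heaviesP Ah => /=.
  apply: leq_trans (leq_add (leqnn _) le2).
  apply: leq_trans (leq_card_setU _ _).
  apply/subset_leq_card/subsetP => A /setIdP[/setDP[Ah _] hv].
  by apply/setUP; case/orP: hv => hv; [left|right]; apply/setIdP.
set miss := _ :\: _ in missK.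
pose X := [set p : {set T} * {set T} |
  [&& p.1 \in heavies, p.2 \in heavies & good p.1 p.2]].
have hX : h * uphalf h <= #|X| * 1.
  apply: (@double_count _ _ _ _ (fun A p => p.1 == A)) => [A Ah|p _].
    apply: leq_trans (manygood A Ah) _.
    rewrite -(@card_in_imset _ _ (pair A)) => [|? ? _ _ []//].
    apply/subset_leq_card/subsetP => _ /imsetP[G /setIdP[Gh gG] ->].
    by apply/setIdP; rewrite inE /= Ah Gh gG.
  rewrite -(cards1 p.1); apply/subset_leq_card/subsetP => A.
  by move=> /setIdP[_ /eqP<-]; rewrite inE.
(* A lower bound for the number of [d]-sets with [2 * s] prescribed witness points and two forbidden
   centres. *)
set cb := 'C(n - (2 * s).+2, d - 2 * s).
set q := 2 ^ d * n ^ (d - s).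
have Xle : #|X| * cb <= #|miss| * (q * q).
  apply: (@double_count _ _ _ _
    (fun p E => (W p.1 \subset E) && (W p.2 \subset E))) => [[A G]|E].
    rewrite inE /= => /and3P[Ah Gh /andP[cG dG]].
    have [AF _ cWA _ _] := heaviesP Ah; have [GF _ cWG sG _] := heaviesP Gh.
    have cAb : c (W A) \notin base G.
      by move: dG; rewrite disjoint_sym => /disjointFr ->; rewrite ?setU11.
    have dW : W A :&: W G = set0.
      apply/eqP; rewrite setIC setI_eq0 (disjointWl sG) // (disjointWr _ dG) //.
      exact: subsetUr.
    have cW : #|W A :|: W G| = 2 * s by rewrite cardsU dW cards0 !Ws // subn0 addnn mul2n.
    rewrite /cb -cW.
    apply: leq_trans (@card_superset_ge _ _ [set c (W A); c (W G)] d _ _ _ _) _.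
    - rewrite disjoint_sym -setI_eq0 setIUl setU_eq0 !setI_eq0 !disjoints1.
      move: cG; rewrite !inE !negb_or cWA cWG => /andP[_ ->] /=; rewrite andbT.
      by apply: contra cAb; apply: (subsetP sG).
    - by rewrite cW.
    - apply: leq_trans (leq_card_setU _ _) _; rewrite cW.
      by rewrite cards2 -[leqRHS]addn2 leq_add2l; case: (_ != _).
    apply/subset_leq_card/subsetP => E.
    rewrite inE subUset => /and3P[/andP[AE GE] cE dE].
    apply/setIdP; rewrite AE GE; split=> //; apply/setDP; rewrite inE; split=> //.
    have [cAE cGE] : c (W A) \notin E /\ c (W G) \notin E.
      by split; move: dE; rewrite disjoint_sym => /disjointFr ->; rewrite ?inE ?eqxx ?orbT.
    apply/imsetP => -[H Hh EH]; have [HF _ _ _ _] := heaviesP Hh.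
    have EsubH : E \subset H by rewrite EH subsetDl.
    (* If [E] is the base of [H], then [H] contains [W B] and hence its centre; a centre outside [E]
       can only be the point removed from [H]. Two distinct centres cannot both be that point. *)
    have key B : B \in heavies -> W B \subset E -> c (W B) \notin E ->
        c (W B) = c (W H).
      move=> Bh BE; rewrite EH in_setD1 negb_and negbK.
      by rewrite (center_heavies Bh HF (subset_trans BE EsubH)) orbF => /eqP.
    move: cG; rewrite (key A Ah AE cAE) (key G Gh GE cGE).
    by rewrite setU11.
  move=> /setDP[]; rewrite inE => /eqP cE _.
  have hE := card_heavies_sub E; rewrite cE -/q in hE.
  apply: leq_trans (leq_mul hE hE); rewrite -cardsX.
  apply/subset_leq_card/subsetP => -[A G] /setIdP[] /=.
  rewrite inE /= => /and3P[Ah Gh _] /andP[AE GE].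
  by apply/setXP; split; apply/setIdP.
have lecb : n ^ (d - 2 * s) <= 2 ^ d * d`! * cb by apply: leq_exp_bin; lia.
move: n3; rewrite ltnNge => /negP[].
have Zgt0 : 0 < n ^ d.-1 * (n ^ d * n ^ (d - 2 * s)).
  by rewrite !muln_gt0 !expn_gt0 n_gt0.
rewrite -(leq_pmul2r Zgt0).
have qq : q * q = 4 ^ d * (n ^ d * n ^ (d - 2 * s)).
  rewrite /q mulnACA -expnMn -!expnD; congr (_ * n ^ _); lia.
rewrite mulnA -(exp_predE d_gt0).
have hX2 : h * h <= 2 * #|X|.
  have h2 : h <= 2 * uphalf h by lia.
  apply: leq_trans (leq_mul (leqnn h) h2) _.
  by rewrite mulnCA leq_mul2l -[#|X|]muln1.
rewrite mulnA; apply: leq_trans (leq_mul (leq_mul hP hP) lecb) _.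
have := leq_mul hX2 (leqnn cb); have := leq_trans Xle (leq_mul missK (leqnn (q * q))).
rewrite {}qq; move: (2 ^ d * d`!) (n ^ d * _) (n ^ d.-1) (4 ^ d) => a b e f.
move=> i1 i2.
have -> : P * h * (P * h) * (a * cb) = P ^ 2 * a * (h * h * cb) by lia.
apply: leq_trans (leq_mul (leqnn _) i2) _.
have -> : P ^ 2 * a * (2 * #|X| * cb) = 2 * P ^ 2 * a * (#|X| * cb) by lia.
apply: leq_trans (leq_mul (leqnn _) i1) _; lia.
Qed.

(** * Families with members that avoid the popular centre *)

Section NonStar.

Variables (x : T) (L : nat).

Let Q := [set A in F | (x \in A) && (x \notin W A)].
Let R := [set G in F | x \notin G].
Let M := [set D : {set T} | [&& #|D| == d, x \notin D & x |: D \notin F]].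
Let Z := M :\: base @: (R :&: heavies).

(** If [x |: base A] were in [F], it would contain [W A] and hence [c (W A)], forcing [x = c (W A)],
    a point of [A]. *)
Lemma base_missing : base @: (R :&: heavies) \subset M.
Proof.
apply/subsetP => _ /imsetP[A /setIP[/setIdP[_ xA] Ah] ->].
have [_ cA _ sW cb] := heaviesP Ah.
have xD : x \notin base A by apply: contra xA; apply/subsetP/subsetDl.
rewrite inE cb eqxx xD /=; apply: contra xA => xDF.
have : c (W A) \in x |: base A.
  by apply: center_heavies => //; apply: subset_trans sW (subsetUr _ _).
by rewrite in_setU1 in_setD1 eqxx orbF => /eqP <-.
Qed.

Lemma card_star :
  #|[set A in F | x \in A]| + #|M| = 'C(n.-1, d).
Proof.
rewrite -(@card_in_imset _ _ (fun A => A :\ x) [set A in F | x \in A]) => [|A G]; last first.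
  by move=> /setIdP[_ xA] /setIdP[_ xG] e; rewrite -(setD1K xA) e setD1K.
rewrite -(cardsC1 x) -cards_draws -cardsUI [X in _ + X](_ : _ = 0) ?addn0.
  apply: eq_card => D; rewrite !inE subsetC sub1set inE; apply/orP/andP.
    case=> [/imsetP[A /setIdP[AF xA] ->]|/and3P[-> -> _]//].
    by rewrite !inE eqxx -eqSS -(FT AF) [X in _ == X](cardsD1 x) xA.
  move=> [xD cD]; have [DF|DF] := boolP (x |: D \in F); [left|by right; apply/and3P].
  by apply/imsetP; exists (x |: D); rewrite ?setU1K // inE DF setU11.
apply/eqP; rewrite cards_eq0; apply/eqP/setP => D; rewrite inE in_set0.
apply/negbTE/negP => /andP[/imsetP[A /setIdP[AF xA] ->]].
by rewrite inE setD1K // AF !andbF.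
Qed.

(** Adding [x] to [D] does not change its trace [W G0] on [G0], so [x |: D] is no member. If [D]
    were the base of some [G], the added centre would have to change the traces on both [G0] and
    [A], hence lie in both, but they are disjoint. *)
Lemma missing_witness G0 A D : G0 \in R -> A \in Q ->
  #|D| = d -> D :&: G0 = W G0 -> D :&: A = W A -> x \notin D ->
  [disjoint A & G0] -> D \in Z.
Proof.
move=> /setIdP[G0F xG0] /setIdP[AF /andP[xA xWA]] cD DG0 DA xD dAG0.
have setIU1 E y : y \notin E -> E :&: (y |: D) = D :&: E.
  move=> yE; rewrite setIUr setIC [D :&: E]setIC.
  by apply/setUidPr; rewrite (disjoint_setI0 _) ?sub0set // disjoints1.
apply/setDP; split.
  rewrite inE cD eqxx xD /=; apply/negP => xDF.
  by have := WP G0F xDF; rewrite setIU1 // DG0 eqxx.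
apply/imsetP => -[G /setIP[_ Gh] DGb]; have [GF _ _ _ _] := heaviesP Gh.
have Geq : G = c (W G) |: D by rewrite DGb baseK.
have cG0 : c (W G) \in G0.
  by have := WP G0F GF; apply: contraNT => cG0; rewrite Geq setIU1 // DG0.
have := WP AF GF; rewrite Geq setIU1 ?DA ?eqxx //.
by rewrite (disjointFl dAG0).
Qed.

(** For each [A] in [Q] disjoint from [G0], take the [d]-sets meeting [G0 :|: A] exactly in the two
    witnesses. A given [D] arises from at most [2 ^ d * n ^ (d - s)] such [A], since [A] contains
    [x] and a witness inside [D]. *)
Lemma card_missing G0 : G0 \in R ->
  n ^ d <= L * #|Q| -> 2 * L * d.+1 <= n -> 2 * (2 * d.+1 + d) <= n ->
  0 < s ->
  n ^ (d - s) <= 2 * L * (2 ^ d * d`!) * 2 ^ d * #|[set D in Z | W G0 \subset D]|.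
Proof.
move=> G0R hL n1 n2 s_gt0; have [G0F xG0] := setIdP G0R.
have n_gt0 : 0 < n by lia.
have d_gt0 : 0 < d by lia.
pose Q0 := [set A in Q | [disjoint A & G0]].
have QF A : A \in Q -> [/\ A \in F, x \in A & x \notin W A].
  by rewrite inE => /and3P.
(* Members of [Q] meeting [G0] contain [x] and a second point, so they cost at most
   [(d + 1) * n ^ (d - 1)], half of the lower bound for [#|Q|]. *)
have hQ : n ^ d <= 2 * L * #|Q0|.
  have : #|Q :\: Q0| * 1 <= #|G0| * n ^ d.-1.
    apply: (@double_count _ _ _ _ (fun A v => v \in A)) => [A|v vG0].
      move=> /setDP[AQ]; rewrite inE AQ /= -setI_eq0 card_gt0.
      move=> /set0Pn[v /setIP[vA vG0]].
      by apply/set0Pn; exists v; apply/setIdP.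
    have nxv : x != v by apply: contraNneq xG0 => ->.
    have -> : d.-1 = d.+1 - #|[set x; v]| by rewrite cards2 nxv; lia.
    apply: leq_trans (card_superset_le _ _).
    apply/subset_leq_card/subsetP => A /setIdP[/setDP[/QF[AF xA _] _] vA].
    by rewrite inE subUset !sub1set xA vA FT //=.
  rewrite cardsDS; last by apply/subsetP => A /setIdP[].
  rewrite FT // muln1 leq_subLR => hQ.
  have := leq_mul n1 (leqnn (n ^ d.-1)); rewrite -exp_predE // => h1.
  have := leq_mul (leqnn (2 * L)) hQ; rewrite mulnDr mulnA -[2 * L * #|Q|]mulnA.
  by move: hL h1; lia.
have hX : #|Q0| * 'C(n - 2 * d.+1, d - 2 * s) <=
    #|[set D in Z | W G0 \subset D]| * (2 ^ d * n ^ (d - s)).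
  apply: (@double_count _ _ _ _ (fun A D => W A \subset D)) => [A|D].
    move=> /setIdP[AQ dAG0]; have [AF xA xWA] := QF A AQ.
    have dI : G0 :&: A = set0 by rewrite setIC disjoint_setI0.
    have dW : W G0 :&: W A = set0.
      by apply/eqP; rewrite -subset0 -dI setISS ?WS.
    have cW : #|W G0 :|: W A| = 2 * s.
      by rewrite cardsU dW cards0 !Ws // subn0 addnn mul2n.
    have WU : W G0 :|: W A \subset G0 :|: A by rewrite setUSS ?WS.
    set Y := (G0 :|: A) :\: (W G0 :|: W A).
    rewrite -cW.
    apply: leq_trans (@card_superset_ge _ _ Y d _ _ _ _) _.
    - by rewrite -setI_eq0 /Y setDE setICA setICr setI0.
    - by rewrite cW.
    - rewrite /Y -{1}(setIidPr WU) setID.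
      by rewrite cardsU dI cards0 subn0 !FT // addnn mul2n.
    apply/subset_leq_card/subsetP => D.
    rewrite inE subUset => /and3P[/andP[G0D AD] /eqP cD dD].
    have DY v : v \in D -> v \in G0 :|: A -> v \in W G0 :|: W A.
      move=> vD vU; have := disjointFr dD vD; rewrite inE vU andbT.
      by move/negbFE.
    apply/setIdP; split=> //; apply/setIdP; split=> //.
    apply: (missing_witness G0R AQ) => //.
    - apply/eqP; rewrite eqEsubset subsetI G0D WS // !andbT.
      apply/subsetP => v /setIP[vD vG0].
      have := DY v vD; rewrite !inE vG0 => /(_ isT) /orP[//|/(subsetP (WS AF))].
      by rewrite (disjointFl dAG0).
    - apply/eqP; rewrite eqEsubset subsetI AD WS // !andbT.
      apply/subsetP => v /setIP[vD vA].
      have := DY v vD; rewrite !inE vA orbT => /(_ isT) /orP[|//].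
      by move/(subsetP (WS G0F)); rewrite (disjointFr dAG0 vA).
    (* The point [x] of [A] lies in neither witness, so it is among the forbidden points [Y]. *)
    apply/negP => xD; have := DY x xD; rewrite !inE xA orbT => /(_ isT).
    rewrite (negbTE xWA) orbF => /(subsetP (WS G0F)).
    by rewrite (negbTE xG0).
  move=> /setIdP[/setDP[]]; rewrite inE => /and3P[/eqP cD _ _] _ _.
  rewrite -[X in 2 ^ X]cD.
  apply: leq_trans (@card_witness_sub Q D (n ^ (d - s)) _ _).
  - apply/subset_leq_card/subsetP => A /setIdP[/setIdP[AQ _] AD].
    by apply/setIdP.
  - by apply/subsetP => A /QF[].
  move=> B cB; have [xB|xB] := boolP (x \in B).
    rewrite [finset _](_ : _ = set0) ?cards0 //; apply/setP => A.
    rewrite in_set0; apply/negbTE/negP => /setIdP[/QF[_ _ +] /eqP WA].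
    by rewrite WA xB.
  have -> : d - s = d.+1 - #|x |: B| by rewrite cardsU1 xB cB add1n subSS.
  apply: leq_trans (card_superset_le _ _).
  apply/subset_leq_card/subsetP => A /setIdP[/QF[AF xA _] /eqP <-].
  by rewrite inE subUset sub1set xA WS //= FT.
have lecb : n ^ (d - 2 * s) <= 2 ^ d * d`! * 'C(n - 2 * d.+1, d - 2 * s).
  by apply: leq_exp_bin; lia.
have Ngt0 : 0 < n ^ (d - s) by rewrite expn_gt0 n_gt0.
rewrite -(leq_pmul2r Ngt0) -expnD.
have -> : d - s + (d - s) = d + (d - 2 * s) by lia.
rewrite expnD; apply: leq_trans (leq_mul hQ lecb) _.
rewrite mulnACA.
apply: leq_trans (leq_mul (leqnn _) hX) _.
by rewrite -!mulnA leq_mul2l !(mulnCA (2 ^ d)) leqnn !orbT.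
Qed.

(** Each witness of [R] lies in order [n ^ (d - s)] sets of [Z], each of which contains at most
    [2 ^ d] witnesses; so [Z] outnumbers the light part of [R], whose fibers have order
    [n ^ (d - s - 1)]. Thus [M] is larger than [R]. *)
Lemma nonstar_bound :
  n ^ d <= L * #|Q| -> 2 * L * d.+1 <= n -> 2 * (2 * d.+1 + d) <= n ->
  0 < s ->
  2 * L * (2 ^ d * d`!) * 2 ^ d * (d.+1 ^ 2 * 2 ^ d).+1 <= n ->
  R != set0 -> #|F| < 'C(n.-1, d).
Proof.
move=> hL n1 n2 s_gt0 n3 R0.
have n_gt0 : 0 < n by lia.
set C0 := 2 * L * _ * _ in n3.
set N := n ^ (d - s).-1.
have N_gt0 : 0 < N by rewrite expn_gt0 n_gt0.
have C0_gt0 : 0 < C0.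
  have [G0 G0R] := set0Pn _ R0; have := card_missing G0R hL n1 n2 s_gt0.
  apply: contraTltn; rewrite -/C0 leqn0 => /eqP->.
  by rewrite mul0n -ltnNge expn_gt0 n_gt0.
have many B : B \in W @: R ->
    (d.+1 ^ 2 * 2 ^ d * N).+1 <= #|[set D in Z | B \subset D]|.
  case/imsetP => G0 G0R ->; have := card_missing G0R hL n1 n2 s_gt0.
  rewrite -/C0 exp_predE; last by lia.
  rewrite -/N => h; rewrite -(leq_pmul2l C0_gt0); apply: leq_trans h.
  apply: leq_trans (leq_mul n3 (leqnn N)); rewrite -[leqRHS]mulnA leq_mul2l.
  by rewrite mulSn -[X in X <= _]add1n leq_add2r N_gt0 orbT.
have hZ : #|W @: R| * (d.+1 ^ 2 * 2 ^ d * N).+1 <= #|Z| * 2 ^ d.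
  apply: (@double_count _ _ _ _ (fun B D => B \subset D)) => // D.
  move=> /setDP[]; rewrite inE => /and3P[/eqP <- _ _] _.
  rewrite -card_powerset; apply/subset_leq_card/subsetP => B.
  by rewrite inE => /andP[_]; rewrite inE.
have RF : R \subset F by apply/subsetP => A /setIdP[].
have light := card_light RF; rewrite -/N in light.
have WR0 : 0 < #|W @: R|.
  by have [G0 G0R] := set0Pn _ R0; rewrite card_gt0; apply/set0Pn; exists (W G0); rewrite imset_f.
have ltZ : #|R :\: heavies| < #|Z|.
  have p2 : 0 < 2 ^ d by rewrite expn_gt0.
  rewrite -(ltn_pmul2r p2); apply: leq_trans hZ.
  apply: leq_ltn_trans (leq_mul light (leqnn _)) _.
  have -> : #|W @: R| * (d.+1 ^ 2 * N) * 2 ^ d = #|W @: R| * (d.+1 ^ 2 * 2 ^ d * N).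
    by rewrite -!mulnA [N * _]mulnC.
  by rewrite ltn_pmul2l.
have cM : #|M| = #|Z| + #|R :&: heavies|.
  rewrite -(@card_in_imset _ _ base (R :&: heavies)) => [|A G]; last first.
    by move=> /setIP[_ Ah] /setIP[_ Gh]; apply: base_inj.
  by rewrite /Z cardsDS ?base_missing // subnK // subset_leq_card ?base_missing.
have cF : #|F| = #|[set A in F | x \in A]| + #|R|.
  rewrite -(cardsID [set A : {set T} | x \in A] F); congr (_ + _); apply: eq_card => A.
    by rewrite !inE.
  by rewrite !inE andbC.
rewrite -card_star cM cF -(cardsID heavies R); lia.
Qed.

End NonStar.

(** * Families at least as large as a star *)

Lemma extremal_star P L :
  0 < s -> P = 2 * (2 ^ d * d`!) -> L = 4 * s.+1 * P ->
  P * d.+1 ^ 2 <= n -> L <= n -> 2 * L * d.+1 <= n ->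
  2 * (2 * d.+1 + d) <= n ->
  2 * P ^ 2 * (2 ^ d * d`!) * (d.+1 ^ 2).+1 * 4 ^ d < n ->
  2 * L * (2 ^ d * d`!) * 2 ^ d * (d.+1 ^ 2 * 2 ^ d).+1 <= n ->
  'C(n.-1, d) <= #|F| ->
  #|F| <= 'C(n.-1, d) /\ exists x, {in F, forall A : {set T}, x \in A}.
Proof.
move=> s_gt0 defP defL n1 n2 n3 n4 n5 n6 Fge.
have n_gt0 : 0 < n by lia.
have d_gt0 : 0 < d by lia.
have light : #|F :\: heavies| <= d.+1 ^ 2 * n ^ d.-1.
  apply: leq_trans (card_light (subxx F)) _; rewrite mulnCA leq_mul2l.
  have -> : d.-1 = s + (d - s).-1 by lia.
  rewrite expnD leq_mul2r; apply/orP; right; apply/orP; right.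
  apply: leq_trans (leq_bin_exp _ _); rewrite -card_draws.
  by apply/subset_leq_card/subsetP => _ /imsetP[A AF ->]; rewrite inE Ws.
have hF : heavies \subset F by apply/subsetP => A /heaviesP[].
rewrite cardsDS // in light.
(* The light members use up at most half of the lower bound for [#|F|], whence the factor 2 in
   [P]. *)
have hP : n ^ d <= P * #|heavies|.
  have bin1 : n ^ d <= 2 ^ d * d`! * 'C(n - 1, d) by apply: leq_exp_bin; lia.
  have := leq_mul n1 (leqnn (n ^ d.-1)); rewrite -exp_predE // => n1'.
  have : 'C(n - 1, d) <= #|heavies| + d.+1 ^ 2 * n ^ d.-1.
    by rewrite subn1; apply: leq_trans Fge _; rewrite -leq_subLR.
  move/(leq_mul (leqnn (2 ^ d * d`!))) => bin2.
  move: n1' bin1 bin2; rewrite defP.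
  by move: (2 ^ d * d`!) (n ^ d) (d.+1 ^ 2) (n ^ d.-1) => a u k v; lia.
have base_draws : base @: heavies \subset [set E : {set T} | #|E| == d].
  apply/subsetP => _ /imsetP[A Ah ->].
  by have [_ _ _ _ cb] := heaviesP Ah; rewrite inE cb.
have miss : #|[set E : {set T} | #|E| == d] :\: base @: heavies| <=
    (d.+1 ^ 2).+1 * n ^ d.-1.
  rewrite cardsDS // card_draws (card_in_imset base_inj).
  (* Pascal's rule: the [d]-sets exceed the size of a star by ['C(n.-1, d.-1)], which is the extra 1
     in the constant [(d.+1 ^ 2).+1]. *)
  have -> : 'C(n, d) = 'C(n.-1, d) + 'C(n.-1, d.-1).
    by rewrite -[in LHS](prednK n_gt0) -(prednK d_gt0) binS.
  have := leq_bin_exp n.-1 d.-1.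
  have : n.-1 ^ d.-1 <= n ^ d.-1.
    by case: (d.-1) => // e; rewrite leq_exp2r // leq_pred.
  by rewrite mulSn; lia.
have n2' : 4 * s.+1 * P <= n by rewrite -defL.
have n4' : 2 * ((2 * s).+2 + d) <= n by lia.
have [x] := popular_center s_gt0 hP miss n2' n4' n5; rewrite -defL => hx.
have hQ : n ^ d <= L * #|[set A in F | (x \in A) && (x \notin W A)]|.
  apply: leq_trans hx _; rewrite leq_mul2l; apply/orP; right.
  apply/subset_leq_card/subsetP => A /setIdP[/heaviesP[AF cA cW _ _] /eqP <-].
  by rewrite inE AF cA cW.
have [R0|R0] := eqVneq [set G in F | x \notin G] set0; last first.
  by have := nonstar_bound hQ n3 n4 s_gt0 n6 R0; rewrite ltnNge Fge.
have star A : A \in F -> x \in A.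
  move=> AF; apply: contraT => xA.
  have : A \in [set G in F | x \notin G] by rewrite inE AF.
  by rewrite R0 inE.
split; last by exists x.
rewrite -(card_star x) (_ : [set A in F | x \in A] = F) ?leq_addr //.
by apply/setP => A; rewrite inE andb_idr //; apply: star.
Qed.

End Center.
End Witness.

Theorem theorem1p4 (d s : nat) :
  1 <= s -> 2 * s <= d ->
  exists n0 : nat, forall n : nat, n0 <= n ->
    forall F : {set {set 'I_n}},
      uniform_family (d.+1) F ->
      s_witness_family s F ->
      #|F| <= 'C(n.-1, d) /\ (#|F| = 'C(n.-1, d) -> is_star F).
Proof.
move=> s_gt0 sd.
pose P := 2 * (2 ^ d * d`!); pose L := 4 * s.+1 * P.
(* The lower bounds on [n] required by [extremal_star]; the successor in the fifth turns its strict
   inequality into a weak one. *)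
pose l := [:: P * d.+1 ^ 2; L; 2 * L * d.+1; 2 * (2 * d.+1 + d);
  (2 * P ^ 2 * (2 ^ d * d`!) * (d.+1 ^ 2).+1 * 4 ^ d).+1;
  2 * L * (2 ^ d * d`!) * 2 ^ d * (d.+1 ^ 2 * 2 ^ d).+1].
exists (\max_(a <- l) a) => n n0n F unifF witF.
have large a : a \in l -> a <= #|'I_n|.
  by rewrite card_ord => al; apply: leq_trans n0n; apply: leq_bigmax_seq al _.
have [Flt|Fge] := ltnP #|F| 'C(n.-1, d).
  by split=> [|eqF]; [exact: ltnW|rewrite eqF ltnn in Flt].
have [W WP] : exists W : {set 'I_n} -> {set 'I_n}, forall A, A \in F ->
    [/\ W A \subset A, #|W A| = s & {in F, forall A', A :&: A' != W A}].
  apply: (@fin_all_exists _ (fun=> {set 'I_n}) (fun A B => A \in F ->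
    [/\ B \subset A, #|B| = s & {in F, forall A', A :&: A' != B}])) => A.
  have [/witF[B BP]|_] := boolP (A \in F); last by exists set0.
  by exists B.
have WS : {in F, forall A : {set 'I_n}, W A \subset A} by move=> A /WP[].
have Ws : {in F, forall A : {set 'I_n}, #|W A| = s} by move=> A /WP[].
have WI : {in F &, forall A A' : {set 'I_n}, A :&: A' != W A}.
  by move=> A A' /WP[_ _]; apply.
(* A point of ['I_n] is needed as the default centre of sets that are not heavy. *)
have n_gt0 : 0 < n.
  by rewrite -[n]card_ord; apply: leq_trans (large (2 * (2 * d.+1 + d)) _); rewrite ?inE ?eqxx ?orbT.
have [c cP] : exists c : {set 'I_n} -> 'I_n, forall B, heavy d s F W B ->
    c B \notin B /\ {in F, forall G : {set 'I_n}, B \subset G -> c B \in G}.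
  apply: (@fin_all_exists _ (fun=> 'I_n) (fun B y => heavy d s F W B ->
    y \notin B /\ {in F, forall G : {set 'I_n}, B \subset G -> y \in G})) => B.
  have [/(heavy_center unifF WS Ws WI)[y yP]|_] := boolP (heavy d s F W B).
    by exists y.
  by exists (Ordinal n_gt0).
have := extremal_star sd unifF WS Ws WI cP s_gt0 (erefl P) (erefl L).
rewrite card_ord => main; have [||||||? star] := main _ _ _ _ _ _ Fge;
  try by rewrite -[leqRHS]card_ord; apply: large; rewrite !inE eqxx ?orbT.
by split.
Qed.
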